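(* Let $X$ and $Y$ be solutions of $$-\bar\Lambda X - X\bar\Lambda + \bar F\bar F^\top = 0,\qquad -\bar\Lambda Y - Y\bar\Lambda + \bar H^\top \bar H \le 0,$$ where $X=X^\top>0$ and $Y=\mathrm{blkdiag}(Y_1,\dots,Y_s)$ with $Y_i=Y_i^\top>0$, $Y_i\in\mathbb{R}^{m_i\times m_i}$. Let $K_m>0$ and $K_M>0$ be the minimum and maximum solutions of $A^\top K+KA\le 0$, $C=B^\top K$. Then the matrices $$\mathcal{X}:=X\otimes K_M^{-1},\qquad \mathcal{Y}:=Y\otimes K_m$$ are, respectively, a generalized controllability Gramian and a generalized observability Gramian of the asymptotically stable system $\mathbf{\Sigma_s}$. Moreover, there exist two nonsingular matrices $T_{\mathcal G}\in\mathbb{R}^{(N-1)\times(N-1)}$ and $T_{\mathcal D}\in\mathbb{R}^{n\times n}$ such that $\mathcal{T}=T_{\mathcal G}\otimes T_{\mathcal D}$ satisfies $$\mathcal{T}\mathcal{X}\mathcal{T}^\top=\mathcal{T}^{-\top}\mathcal{Y}\mathcal{T}^{-1}=\Sigma_{\mathcal G}\otimes\Sigma_{\mathcal D},$$ where $\Sigma_{\mathcal G}=\mathrm{diag}(\sigma_1,\dots,\sigma_{N-1})$ and $\Sigma_{\mathcal D}=\mathrm{diag}(\tau_1,\dots,\tau_n)$, and $\sigma_1\ge\cdots\ge\sigma_{N-1}$ and $\tau_1\ge\cdots\ge\tau_n$ are the square roots of the eigenvalues (with multiplicity) of $XY$ and of $K_M^{-1}K_m$, respectively.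
   Context: Agents: $A\in\mathbb{R}^{n\times n}$, $B\in\mathbb{R}^{n\times m}$, $C\in\mathbb{R}^{m\times n}$ define the agent system $\dot x_i=Ax_i+B\nu_i$, $\eta_i=Cx_i$. Standing assumption: this realization is minimal and passive, where passivity means that there is a symmetric positive definite $K$ with $A^\top K+KA\le 0$ and $C=B^\top K$. Minimum and maximum solutions $K_m,K_M$ are understood in the Loewner order: both are symmetric positive definite solutions, and $K_m\le K\le K_M$ for every symmetric positive definite solution $K$. Network: $L\in\mathbb{R}^{N\times N}$ is the Laplacian of a connected, undirected, weighted graph on $N$ nodes: $L_{ij}=-w_{ij}$ for $i\ne j$ and $L_{ii}=\sum_{j\neq i}w_{ij}$, with weights $w_{ij}=w_{ji}\ge0$. $F\in\mathbb{R}^{N\times p}$ and $H\in\mathbb{R}^{q\times N}$. Fix a spectral decomposition $L=T\,\mathrm{blkdiag}(\bar\Lambda,0)\,T^\top$ with $T=[T_1\ T_2]$ orthogonal, $T_2=\mathbf{1}_N/\sqrt N$ ($\mathbf 1_N$ the all-ones vector), $\bar\Lambda=\mathrm{diag}(\lambda_1,\dots,\lambda_{N-1})$, where $\lambda_1\ge\cdots\ge\lambda_{N-1}>0$ are the nonzero eigenvalues of $L$. Write $\bar\Lambda=\mathrm{blkdiag}(\bar\lambda_1 I_{m_1},\dots,\bar\lambda_s I_{m_s})$ with $\bar\lambda_1>\cdots>\bar\lambda_s$ the distinct nonzero eigenvalues and $m_i$ their multiplicities. Set $\bar F=T_1^\top F$, $\bar H=HT_1$. The system $\mathbf{\Sigma_s}$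 is $\dot z_s=(I_{N-1}\otimes A-\bar\Lambda\otimes BC)z_s+(\bar F\otimes B)u$, $y_s=(\bar H\otimes C)z_s$ (it is asymptotically stable). With $\Phi:=I_{N-1}\otimes A-\bar\Lambda\otimes BC$, a positive definite $\mathcal X$ is called a generalized controllability Gramian of $\mathbf{\Sigma_s}$ if $\Phi\mathcal X+\mathcal X\Phi^\top+(\bar F\otimes B)(\bar F^\top\otimes B^\top)\le0$, and a positive definite $\mathcal Y$ is called a generalized observability Gramian of $\mathbf{\Sigma_s}$ if $\Phi^\top\mathcal Y+\mathcal Y\Phi+(\bar H^\top\otimes C^\top)(\bar H\otimes C)\le0$. Matrix inequalities are in the sense of symmetric (semi)definiteness; $\otimes$ is the Kronecker product. *)

(* Defs.v *)
From mathcomp Require Import all_boot all_order all_algebra.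
From mathcomp Require Import mxtens.
From mathcomp Require Import boolp classical_sets reals topology normedtype derive.

Set Implicit Arguments.
Unset Strict Implicit.
Unset Printing Implicit Defensive.

Import Order.TTheory GRing.Theory Num.Theory.
Import numFieldNormedType.Exports.
Local Open Scope ring_scope.

(* Matrix inequalities refer to symmetric matrices: the symmetry of the matrix
   is part of each of the definitions below. *)
Definition posdefmx (R : realType) (n : nat) (M : 'M[R]_n) : Prop :=
  M^T = M /\ forall x : 'cV[R]_n, x != 0 -> 0 < (x^T *m M *m x) ord0 ord0.

Definition possemidefmx (R : realType) (n : nat) (M : 'M[R]_n) : Prop :=
  M^T = M /\ forall x : 'cV[R]_n, 0 <= (x^T *m M *m x) ord0 ord0.

Definition loewner_le (R : realType) (n : nat) (M P : 'M[R]_n) : Prop :=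
  possemidefmx (P - M).

Definition orthogonalmx (R : realType) (a b : nat) (T : 'M[R]_(a, b)) : Prop :=
  T^T *m T = 1%:M /\ T *m T^T = 1%:M.

(* [C (s I - A)^-1 B], as a matrix of rational functions in the indeterminate
   [s]; [char_poly_mx A] is [s I - A], which is always invertible over the
   field of rational functions. *)
Definition transfer_function (R : realType) (n m p : nat)
    (A : 'M[R]_n) (B : 'M[R]_(n, m)) (C : 'M[R]_(p, n)) :
    'M[{fraction {poly R}}]_(p, m) :=
  let cst (c : R) : {fraction {poly R}} := tofrac c%:P in
  map_mx cst C *m invmx (map_mx (@tofrac _) (char_poly_mx A)) *m map_mx cst B.

Definition minimal_realization (R : realType) (n m p : nat)
    (A : 'M[R]_n) (B : 'M[R]_(n, m)) (C : 'M[R]_(p, n)) : Prop :=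
  forall (k : nat) (A' : 'M[R]_k) (B' : 'M[R]_(k, m)) (C' : 'M[R]_(p, k)),
    transfer_function A' B' C' = transfer_function A B C -> (n <= k)%N.

Definition passivity_solution (R : realType) (n m : nat)
    (A : 'M[R]_n) (B : 'M[R]_(n, m)) (C : 'M[R]_(m, n)) (K : 'M[R]_n) : Prop :=
  [/\ posdefmx K, loewner_le (A^T *m K + K *m A) 0 & C = B^T *m K].

Definition passive_realization (R : realType) (n m : nat)
    (A : 'M[R]_n) (B : 'M[R]_(n, m)) (C : 'M[R]_(m, n)) : Prop :=
  exists K : 'M[R]_n, passivity_solution A B C K.

Definition minimum_solution (R : realType) (n m : nat)
    (A : 'M[R]_n) (B : 'M[R]_(n, m)) (C : 'M[R]_(m, n)) (Km : 'M[R]_n) : Prop :=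
  passivity_solution A B C Km /\
  forall K : 'M[R]_n, passivity_solution A B C K -> loewner_le Km K.

Definition maximum_solution (R : realType) (n m : nat)
    (A : 'M[R]_n) (B : 'M[R]_(n, m)) (C : 'M[R]_(m, n)) (KM : 'M[R]_n) : Prop :=
  passivity_solution A B C KM /\
  forall K : 'M[R]_n, passivity_solution A B C K -> loewner_le K KM.

(* An undirected weighted graph on ['I_N] is a matrix of nonnegative symmetric
   weights; [{i, j}] is an edge when [i != j] and [w i j] is nonzero. The
   diagonal of [w] is irrelevant. *)
Definition weighted_graph (R : realType) (N : nat) (w : 'M[R]_N) : Prop :=
  forall i j : 'I_N, i != j -> 0 <= w i j /\ w i j = w j i.

Definition edge (R : realType) (N : nat) (w : 'M[R]_N) : rel 'I_N :=
  fun i j => (i != j) && (w i j != 0).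

Definition connected_graph (R : realType) (N : nat) (w : 'M[R]_N) : Prop :=
  forall i j : 'I_N, connect (edge w) i j.

Definition laplacian (R : realType) (N : nat) (w : 'M[R]_N) : 'M[R]_N :=
  \matrix_(i, j) if i == j then \sum_(k | k != i) w i k else - w i j.

(* The distinct nonzero eigenvalues [lam i], repeated [mult i] times. *)
Definition Lambdabar (R : realType) (s : nat) (mult : 'I_s -> nat)
    (lam : 'I_s -> R) : 'M[R]_(\sum_(i < s) mult i) :=
  \mxdiag_(i < s) ((lam i)%:M : 'M[R]_(mult i)).

Definition Phi (R : realType) (d n m : nat) (Lam : 'M[R]_d)
    (A : 'M[R]_n) (B : 'M[R]_(n, m)) (C : 'M[R]_(m, n)) : 'M[R]_(d * n) :=
  1%:M *t A - Lam *t (B *m C).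

(* Solutions on [[0, +oo[] of [z' = M z], componentwise. The values of [z] at
   negative times are irrelevant: requiring a two-sided derivative at [0] is no
   restriction, since they can be chosen freely. *)
Definition trajectory (R : realType) (n : nat) (M : 'M[R]_n)
    (z : R -> 'cV[R]_n) : Prop :=
  forall (t : R) (i : 'I_n), 0 <= t ->
    is_derive t 1 (fun u : R => z u i ord0) ((M *m z t) i ord0).

(* Asymptotic stability of the origin for the unforced system: stability in the
   sense of Lyapunov, and convergence of all the trajectories to the origin. *)
Definition asymptotically_stable (R : realType) (n : nat) (M : 'M[R]_n) : Prop :=
  (forall e : R, 0 < e -> exists2 d : R, 0 < d &
     forall z : R -> 'cV[R]_n, trajectory M z ->
       (forall i : 'I_n, `|z 0 i ord0| < d) ->
       forall (t : R) (i : 'I_n), 0 <= t -> `|z t i ord0| < e) /\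
  (forall z : R -> 'cV[R]_n, trajectory M z ->
     forall i : 'I_n, (z t i ord0 @[t --> +oo%R] --> (0 : R))%classic).

Definition gen_controllability_gramian (R : realType) (n p : nat)
    (M : 'M[R]_n) (G : 'M[R]_(n, p)) (X : 'M[R]_n) : Prop :=
  posdefmx X /\ loewner_le (M *m X + X *m M^T + G *m G^T) 0.

Definition gen_observability_gramian (R : realType) (n q : nat)
    (M : 'M[R]_n) (G : 'M[R]_(q, n)) (Y : 'M[R]_n) : Prop :=
  posdefmx Y /\ loewner_le (M^T *m Y + Y *m M + G^T *m G) 0.

(* [v] lists, in nonincreasing order and with algebraic multiplicities, the
   square roots of the eigenvalues of [M]; in particular all the eigenvalues
   of [M] are real and nonnegative. *)
Definition sorted_sqrt_eigenvalues (R : realType) (n : nat) (M : 'M[R]_n)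
    (v : 'rV[R]_n) : Prop :=
  (forall i j : 'I_n, (i <= j)%N -> v ord0 j <= v ord0 i) /\
  exists a : 'I_n -> R,
    char_poly M = \prod_(i < n) ('X - (a i)%:P) /\
    forall i : 'I_n, 0 <= a i /\ v ord0 i = Num.sqrt (a i).

(* Main.v *)
Require Import Defs.
From mathcomp Require Import all_boot all_order all_fingroup all_algebra.
From mathcomp Require Import mxtens complex spectral.
From mathcomp Require Import boolp classical_sets functions reals topology.
From mathcomp Require Import normedtype derive realfun.
From mathcomp Require Import lra.

(** Everything rests on one identity. If [K] is symmetric and [C = B^T K],
    then, writing [Phi] for [I (x) A - Lam (x) B C],
      [Phi^T (Y (x) K) + (Y (x) K) Phi
         = Y (x) (A^T K + K A) - (Lam Y + Y Lam) (x) C^T C]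
    ([Phi_lyapunov]). Since Kronecker products of positive semidefinite
    matrices are positive semidefinite, the network inequality for [Y] and the
    passivity inequality for [K] together make [Y (x) K] a generalized
    observability Gramian. The controllability statement is the same fact for
    the dual system [(A^T, C^T, B^T)], for which [K^-1] solves the passivity
    inequality ([passivity_solution_dual]).

    For [Y = I] the same identity says that along a trajectory [z] the energy
    [z^T (I (x) K) z] is nonincreasing, which gives boundedness and Lyapunov
    stability, and that it decreases at least at the rate [|(S (x) C) z|^2],
    where [Lam = S^T S]. The energy converges, so by Barbalat's lemma
    ([derivative_cvg0]) its derivative tends to zero, and hence so does
    [(I (x) C) z]. The matrices [Q] for which [(I (x) Q) z] tends to zero are
    stable under [Q |-> Q A]: differentiate, apply Barbalat's lemma again, and
    use that the coupling term [(Lam (x) Q B) (I (x) C) z] vanishes in the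
    limit. Minimality forces every [A]-stable space of row vectors
    containing the rows of [C] to be the whole space, for otherwise the
    restriction of [A] to it gives a smaller realization of the same transfer
    function ([observable_ind]); so [z] itself tends to zero.

    Finally, any two positive definite matrices can be balanced, that is,
    carried to the same diagonal matrix by a single change of coordinates
    ([balancing]). Doing this separately for the pairs [(X, Y)] and
    [(K_M^-1, K_m)], and tensoring the two changes of coordinates, balances the
    two Gramians. This uses the spectral theorem for real symmetric matrices
    ([symmetric_spectral]), which also provides the factorisations [M = S^T S]
    behind all the positivity statements. *)

Set Implicit Arguments.
Unset Strict Implicit.
Unset Printing Implicit Defensive.

Import Order.TTheory GRing.Theory Num.Theory.
Import numFieldNormedType.Exports.
Local Open Scope ring_scope.

(** * Orthogonal diagonalisation of real symmetric matrices *)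

Lemma mulmx_tr_eq0 (R : rcfType) n (v : 'rV[R]_n) :
  ((v *m v^T) 0 0 == 0) = (v == 0).
Proof.
have E : (v *m v^T) 0 0 = \sum_j v 0 j ^+ 2.
  by rewrite mxE; apply: eq_bigr => j _; rewrite mxE expr2.
rewrite E psumr_eq0; last by move=> j _; exact: sqr_ge0.
apply/allP/eqP => [h|-> j _]; last by rewrite mxE expr0n eqxx.
apply/rowP => j; rewrite mxE; apply/eqP; rewrite -sqrf_eq0.
exact: (h j (mem_index_enum j)).
Qed.

Lemma mulmx_tr_ge0 (R : rcfType) n (v : 'rV[R]_n) : 0 <= (v *m v^T) 0 0.
Proof. by rewrite mxE sumr_ge0 // => j _; rewrite mxE -expr2 sqr_ge0. Qed.

(** A complex eigenvector [x + iy] of [M], with eigenvalue [a + ib], satisfies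
    [xM = ax - by] and [yM = bx + ay]; by symmetry [xMy^T = yMx^T], so that
    [b (|x|^2 + |y|^2) = 0], and [x] or [y] is a real eigenvector. *)
Lemma symmetric_eigenvalue (R : rcfType) n (M : 'M[R]_n.+1) :
  M^T = M -> exists a, eigenvalue M a.
Proof.
move=> symM.
have [[a b]] := eigenvalue_closed (map_mx (real_complex R) M) isT.
case/eigenvalueP => v vM v0.
pose x := map_mx (@complex.Re R) v; pose y := map_mx (@complex.Im R) v.
have ReIm (f := @complex.Re R) (g := @complex.Im R) I (r : seq I) F :
    f (\sum_(i <- r) F i) = \sum_(i <- r) f (F i) /\
    g (\sum_(i <- r) F i) = \sum_(i <- r) g (F i).
  split; apply: big_morph => //; by [move=> [? ?] [? ?]|].
have xM : x *m M = a *: x - b *: y.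
  apply/rowP => k.
  have := congr1 (@complex.Re R) (congr1 (fun w : 'rV_ _ => w 0 k) vM).
  rewrite !mxE (ReIm _ _ _).1 /= => h; apply: etrans (etrans _ h) _.
    apply: eq_bigr => j _; rewrite !mxE.
    by case: (v 0 j) => ? ? /=; rewrite mulr0 subr0.
  by case: (v 0 k).
have yM : y *m M = b *: x + a *: y.
  apply/rowP => k.
  have := congr1 (@complex.Im R) (congr1 (fun w : 'rV_ _ => w 0 k) vM).
  rewrite !mxE (ReIm _ _ _).2 /= => h; apply: etrans (etrans _ h) _.
    apply: eq_bigr => j _; rewrite !mxE.
    by case: (v 0 j) => ? ? /=; rewrite mulr0 add0r.
  by case: (v 0 k) => ? ? /=; rewrite addrC.
have xy0 : x = 0 -> y != 0.
  move=> x0; apply: contraNneq v0 => y0; apply/eqP/rowP => k.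
  have := congr1 (fun w : 'rV_ _ => w 0 k) y0.
  have := congr1 (fun w : 'rV_ _ => w 0 k) x0.
  by rewrite !mxE; case: (v 0 k) => ? ? /= -> ->.
have tr11 (u : 'M[R]_1) : u^T = u by apply/matrixP => i j; rewrite mxE !ord1.
have sxy : x *m M *m y^T = y *m M *m x^T.
  by rewrite -[LHS]tr11 !trmx_mul trmxK symM mulmxA.
have xy : y *m x^T = x *m y^T by rewrite -[LHS]tr11 trmx_mul trmxK.
have : b *: (x *m x^T + y *m y^T) = 0.
  move: sxy; rewrite xM yM mulmxBl mulmxDl -!scalemxAl xy => /esym h.
  apply: (addIr (a *: (x *m y^T))).
  by rewrite add0r scalerDr addrAC h subrK.
move/eqP; rewrite scalemx_eq0 => /orP[/eqP b0|/eqP/matrixP/(_ 0 0)]; last first.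
  rewrite [LHS]mxE [RHS]mxE => /eqP; rewrite paddr_eq0 ?mulmx_tr_ge0 //.
  by rewrite !mulmx_tr_eq0 => /andP[/eqP/xy0/negPf->].
exists a; apply/eigenvalueP; have [x0|nx0] := eqVneq x 0; last first.
  by exists x; rewrite // xM b0 scale0r subr0.
by exists y; [rewrite yM b0 scale0r add0r|exact: xy0].
Qed.

(** The Householder reflection along [v - e], with [e] the first basis vector,
    maps [e] to [v]. *)
Lemma orthogonal_of_first_row (R : rcfType) n (v : 'rV[R]_n.+1) :
  v *m v^T = 1%:M -> exists Q : 'M[R]_n.+1, Q *m Q^T = 1%:M /\ row 0 Q = v.
Proof.
move=> v1; pose e : 'rV[R]_n.+1 := delta_mx 0 0.
have [ve|nve] := eqVneq v e.
  by exists 1%:M; rewrite trmx1 mulmx1 row1.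
have [u uE] : exists u, u = v - e by exists (v - e).
pose c := (u *m u^T) 0 0.
have c0 : c != 0 by rewrite mulmx_tr_eq0 uE subr_eq0.
have uu : u *m u^T = c%:M by exact: mx11_scalar.
(* [|u|^2 = 2 (1 - <e, v>) = - 2 <e, u>] since [e] and [v] are unit vectors *)
have eu : e *m u^T = (- (c / 2%:R))%:M.
  rewrite [LHS]mx11_scalar; congr (_%:M).
  have ee : e *m e^T = 1%:M.
    by rewrite trmx_delta mul_delta_mx; apply/matrixP => i j; rewrite !mxE !ord1.
  have ve : e *m v^T = v *m e^T.
    apply/matrixP => i j; rewrite !ord1 -[in RHS](trmxK (v *m e^T)).
    by rewrite trmx_mul trmxK [RHS]mxE.
  have -> : c = 2%:R * (1 - (e *m v^T) 0 0).
    rewrite /c uE linearB /= mulmxBl !mulmxBr v1 ee -ve !mxE.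
    by rewrite !eqxx mulr_natl mulr2n opprB.
  rewrite mulrAC divff ?pnatr_eq0 // mul1r opprB uE linearB /= mulmxBr ee.
  by rewrite !mxE eqxx.
pose Q : 'M[R]_n.+1 := 1%:M - (2%:R / c) *: (u^T *m u).
have Qt : Q^T = Q by rewrite /Q linearB /= linearZ /= trmx1 trmx_mul trmxK.
exists Q; split; last first.
  rewrite rowE -/e /Q mulmxBr mulmx1 -scalemxAr mulmxA eu mul_scalar_mx.
  rewrite scalerA mulrN mulrA mulfVK // divff ?pnatr_eq0 // scaleN1r opprK.
  by rewrite uE addrC subrK.
rewrite Qt /Q mulmxBl mul1mx -scalemxAl mulmxBr mulmx1 -scalemxAr.
rewrite mulmxA -[_ *m u^T]mulmxA uu mul_mx_scalar -scalemxAl.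
rewrite scalerA mulfVK // scaler_nat mulr2n opprD addrA subrr add0r.
by rewrite scalerN opprK subrK.
Qed.

(** Induction on the size: in an orthonormal basis whose first vector is an
    eigenvector, a symmetric matrix is block diagonal. *)
Lemma symmetric_spectral (R : rcfType) n (M : 'M[R]_n) :
  M^T = M -> exists (U : 'M[R]_n) (d : 'rV[R]_n),
    U *m U^T = 1%:M /\ M = U^T *m diag_mx d *m U.
Proof.
elim: n M => [|n IH] M symM.
  by exists 1%:M, 0; split; apply/matrixP => [[]].
have [a /eigenvalueP[v0 v0M v0n]] := symmetric_eigenvalue symM.
have r0 : 0 < (v0 *m v0^T) 0 0.
  by rewrite lt_neqAle mulmx_tr_ge0 eq_sym mulmx_tr_eq0 v0n.
pose v := (Num.sqrt ((v0 *m v0^T) 0 0))^-1 *: v0.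
have vM : v *m M = a *: v by rewrite -scalemxAl v0M scalerA mulrC -scalerA.
have v1 : v *m v^T = 1%:M.
  rewrite /v linearZ /= -scalemxAl -scalemxAr scalerA -expr2 exprVn.
  rewrite sqr_sqrtr ?ltW // [X in _ *: X]mx11_scalar scale_scalar_mx.
  by rewrite mulVf // gt_eqF.
have [Q [QQ Qv]] := orthogonal_of_first_row v1.
have QtQ : Q^T *m Q = 1%:M by exact: mulmx1C.
have [P PQ] : exists P : 'M[R]_(1 + n), P = Q *m M *m Q^T.
  by exists (Q *m M *m Q^T).
have symP : P^T = P by rewrite PQ !trmx_mul trmxK symM mulmxA.
have rowP0 : row 0 P = a *: delta_mx 0 0.
  by rewrite PQ !row_mul Qv vM -scalemxAl -Qv -row_mul QQ row1.
have [U' [d' [U'U' PE]]] := IH (drsubmx P) (etrans (trmx_drsub P) (congr1 _ symP)).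
have urP : ursubmx P = 0.
  apply/matrixP => i j; rewrite !mxE ord1.
  have := congr1 (fun w : 'rV_(1 + n) => w 0 (rshift 1 j)) rowP0.
  by rewrite !mxE /= mulr0 => <-; congr (P _ _); apply/val_inj.
have dlP : dlsubmx P = 0 by rewrite -[P]symP -trmx_ursub urP trmx0.
have ulP : ulsubmx P = a%:M.
  apply/matrixP => i j; rewrite !mxE !ord1.
  have := congr1 (fun w : 'rV_(1 + n) => w 0 (lshift n 0)) rowP0.
  by rewrite !mxE /= mulr1 => <-; congr (P _ _); apply/val_inj.
pose W : 'M[R]_(1 + n) := block_mx 1%:M 0 0 U'.
have WW : W *m W^T = 1%:M.
  rewrite /W tr_block_mx !trmx0 trmx1 mulmx_block !mulmx0 !mul0mx U'U'.
  by rewrite !addr0 mul1mx add0r -scalar_mx_block.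
have PW : P = W^T *m diag_mx (row_mx a%:M d') *m W.
  rewrite -[P]submxK urP dlP ulP PE /W diag_mx_row tr_block_mx !trmx0 trmx1.
  rewrite !mulmx_block !(mulmx0, mul0mx) !addr0 !add0r mul1mx mulmx1.
  by rewrite !mul0mx; congr block_mx; apply/matrixP => i j; rewrite !mxE !ord1.
exists (W *m Q), (row_mx a%:M d'); split.
  by rewrite trmx_mul mulmxA -[W *m Q *m _]mulmxA QQ mulmx1 WW.
rewrite trmx_mul !mulmxA -[in RHS](mulmxA Q^T) -(mulmxA Q^T (W^T *m _)) -PW.
by rewrite PQ !mulmxA QtQ mul1mx -mulmxA QtQ mulmx1.
Qed.

Lemma sorting_perm (R : rcfType) n (d : 'rV[R]_n) :
  exists s : 'S_n, forall i j : 'I_n, (i <= j)%N -> d 0 (s j) <= d 0 (s i).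
Proof.
pose t := [tuple d 0 i | i < n].
have /tuple_permP[s st] : perm_eq (sort >=%R t) t by rewrite perm_sort.
have sd (i : 'I_n) : nth 0 (sort >=%R t) i = d 0 (s i).
  by rewrite st (nth_mktuple (fun i => tnth t (s i))) tnth_mktuple.
exists s => i j ij; rewrite -!sd.
have geT : total (>=%R : rel R) by move=> x y; exact: le_total.
have trT : transitive (>=%R : rel R) by move=> x y z /= xy yz; exact: le_trans xy.
have rfT : reflexive (>=%R : rel R) by move=> x; exact: le_refl.
by apply: (sorted_leq_nth trT rfT 0 (sort_sorted geT t)) => //;
  rewrite inE size_sort size_tuple.
Qed.

Lemma symmetric_spectral_sorted (R : rcfType) n (M : 'M[R]_n) :
  M^T = M -> exists (U : 'M[R]_n) (d : 'rV[R]_n),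
    [/\ U *m U^T = 1%:M, M = U^T *m diag_mx d *m U
      & forall i j : 'I_n, (i <= j)%N -> d 0 j <= d 0 i].
Proof.
move=> /symmetric_spectral[U [d [UU ->]]]; have [s hs] := sorting_perm d.
pose P : 'M[R]_n := perm_mx s; have PP : P *m P^T = 1%:M.
  by rewrite tr_perm_mx -perm_mxM mulgV perm_mx1.
have PtP : P^T *m P = 1%:M by exact: mulmx1C.
have Pd : diag_mx (\row_i d 0 (s i)) = P *m diag_mx d *m P^T.
  rewrite tr_perm_mx -row_permE -col_permE.
  by apply/matrixP => i j; rewrite !mxE (inj_eq perm_inj).
exists (P *m U), (\row_i d 0 (s i)); split=> [||i j ij].
- by rewrite trmx_mul mulmxA -[P *m U *m _]mulmxA UU mulmx1.
- rewrite Pd trmx_mul !mulmxA -[U^T *m P^T *m P]mulmxA PtP mulmx1.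
  by rewrite -[_ *m P^T *m P]mulmxA PtP mulmx1.
- by rewrite !mxE hs.
Qed.

(** * Positive definite matrices *)

Lemma quad_mulmx (R : realType) k n (S : 'M[R]_(k, n)) (W : 'M[R]_k) (x : 'cV[R]_n) :
  (x^T *m (S^T *m W *m S) *m x) ord0 ord0 =
  ((S *m x)^T *m W *m (S *m x)) ord0 ord0.
Proof. by rewrite trmx_mul !mulmxA. Qed.

Lemma possemidef_gram (R : realType) k n (S : 'M[R]_(k, n)) : possemidefmx (S^T *m S).
Proof.
split=> [|x]; first by rewrite trmx_mul trmxK.
rewrite -[S^T]mulmx1 quad_mulmx mulmx1 -{2}[S *m x]trmxK; exact: mulmx_tr_ge0.
Qed.

Lemma posdef_gram (R : realType) n (S : 'M[R]_n) : S \in unitmx -> posdefmx (S^T *m S).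
Proof.
move=> uS; split=> [|x x0]; first by rewrite trmx_mul trmxK.
rewrite -[S^T]mulmx1 quad_mulmx mulmx1 -{2}[S *m x]trmxK.
rewrite lt_neqAle mulmx_tr_ge0 andbT eq_sym mulmx_tr_eq0 trmx_eq0.
by apply: contra x0 => /eqP Sx; rewrite -[x](mulKmx uS) Sx mulmx0.
Qed.

Lemma posdef1 (R : realType) n : posdefmx (1%:M : 'M[R]_n).
Proof. by rewrite -[1%:M]mulmx1 -{1}trmx1; exact: posdef_gram (unitmx1 _ _). Qed.

Lemma posdef_possemidef (R : realType) n (M : 'M[R]_n) : posdefmx M -> possemidefmx M.
Proof.
case=> symM pM; split=> // x; have [->|/pM/ltW//] := eqVneq x 0.
by rewrite mulmx0 mxE.
Qed.

Lemma possemidefD (R : realType) n (M P : 'M[R]_n) :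
  possemidefmx M -> possemidefmx P -> possemidefmx (M + P).
Proof.
move=> [sM pM] [sP pP]; split=> [|x]; first by rewrite linearD /= sM sP.
by rewrite mulmxDr mulmxDl mxE addr_ge0.
Qed.

Lemma possemidef_congr (R : realType) k n (M : 'M[R]_k) (S : 'M[R]_(k, n)) :
  possemidefmx M -> possemidefmx (S^T *m M *m S).
Proof.
move=> [sM pM]; split=> [|x]; first by rewrite !trmx_mul trmxK sM mulmxA.
by rewrite quad_mulmx.
Qed.

Lemma loewner_le_refl (R : realType) n (M : 'M[R]_n) : loewner_le M M.
Proof.
by rewrite /loewner_le subrr; split=> [|x]; rewrite ?trmx0 // mulmx0 mul0mx mxE.
Qed.

Lemma loewner_le0_drop_gram (R : realType) k n (W : 'M[R]_n) (D : 'M[R]_(k, n)) :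
  loewner_le (W + D^T *m D) 0 -> loewner_le W 0.
Proof.
move=> hD; rewrite /loewner_le (_ : 0 - W = 0 - (W + D^T *m D) + D^T *m D).
  exact: possemidefD hD (possemidef_gram D).
by rewrite !sub0r opprD subrK.
Qed.

Lemma posdef_mxdiag (R : realType) s (r : 'I_s -> nat) (M : forall i, 'M[R]_(r i)) :
  (forall i, posdefmx (M i)) -> posdefmx (\mxdiag_(i < s) M i).
Proof.
move=> pM; split=> [|x x0].
  by rewrite tr_mxdiag; apply: eq_mxdiag => i; exact: (pM i).1.
rewrite -[x]submxcolK tr_mxcol mul_mxrow_mxdiag mul_mxrow_mxcol summxE.
have ge0 i : 0 <= ((submxcol x i)^T *m M i *m submxcol x i) ord0 ord0.
  exact: (posdef_possemidef (pM i)).2.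
rewrite lt_neqAle sumr_ge0 // andbT eq_sym psumr_eq0 //.
apply: contra x0 => /allP h; apply/eqP; rewrite -[x]submxcolK.
apply/mxcolP => i; rewrite mxcolK submxcol0.
apply/eqP; apply: contraT => /(pM i).2.
by rewrite (eqP (h i (mem_index_enum i))) ltxx.
Qed.

(** The rows of [U] are eigenvectors, at which the quadratic form takes the
    values [d 0 i]: definiteness of a matrix thus gives the signs of its
    eigenvalues. *)
Lemma spectral_quad (R : realType) n (U : 'M[R]_n) (d : 'rV[R]_n) i :
  U *m U^T = 1%:M ->
  ((col i U^T)^T *m (U^T *m diag_mx d *m U) *m col i U^T) ord0 ord0 = d 0 i /\
  col i U^T != 0.
Proof.
move=> UU; have e : U *m col i U^T = delta_mx i 0 by rewrite colE mulmxA UU mul1mx.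
split; last by apply: contraTneq isT => c0; move/matrixP/(_ i 0): e;
  rewrite c0 mulmx0 !mxE !eqxx => /eqP; rewrite eq_sym oner_eq0.
rewrite quad_mulmx e trmx_delta -rowE row_diag_mx -scalemxAl mul_delta_mx.
by rewrite !mxE !eqxx mulr1.
Qed.

Lemma diag_sqrt (R : realType) n (d : 'rV[R]_n) : (forall i, 0 <= d 0 i) ->
  diag_mx d = (diag_mx (map_mx Num.sqrt d))^T *m diag_mx (map_mx Num.sqrt d).
Proof.
move=> d0; rewrite tr_diag_mx mulmx_diag; congr diag_mx; apply/rowP => i.
by rewrite !mxE -expr2 sqr_sqrtr.
Qed.

Lemma diag_mx_unit (R : realType) n (d : 'rV[R]_n) :
  (forall i, 0 < d 0 i) -> diag_mx d \in unitmx.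
Proof.
move=> d0; rewrite unitmxE det_diag unitfE; apply/prodf_neq0 => i _.
by rewrite gt_eqF.
Qed.

Lemma possemidef_factor (R : realType) n (M : 'M[R]_n) :
  possemidefmx M -> exists S : 'M[R]_n, M = S^T *m S.
Proof.
case=> /symmetric_spectral[U [d [UU ->]]] pM.
have d0 i : 0 <= d 0 i by rewrite -(spectral_quad d i UU).1.
exists (diag_mx (map_mx Num.sqrt d) *m U).
by rewrite trmx_mul {1}(diag_sqrt d0) !mulmxA.
Qed.

Lemma posdef_factor (R : realType) n (M : 'M[R]_n) :
  posdefmx M -> exists2 S : 'M[R]_n, S \in unitmx & M = S^T *m S.
Proof.
move=> pM; have [S MS] := possemidef_factor (posdef_possemidef pM); exists S => //.
rewrite -unitmx_tr -row_free_unit; apply/row_freeP.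
have kS : kermx S^T = 0.
  apply/row_matrixP => i; rewrite row0; apply/eqP; apply: contraT.
  rewrite -trmx_eq0 => /pM.2; rewrite MS trmxK mulmxA -row_mul.
  by rewrite mulmx_ker row0 !mul0mx mxE ltxx.
by apply/row_freeP; rewrite -kermx_eq0 kS.
Qed.

Lemma posdef_unit (R : realType) n (M : 'M[R]_n) : posdefmx M -> M \in unitmx.
Proof. by move=> /posdef_factor[S uS ->]; rewrite unitmx_mul unitmx_tr uS. Qed.

Lemma posdef_inv (R : realType) n (M : 'M[R]_n) : posdefmx M -> posdefmx (invmx M).
Proof.
move=> /posdef_factor[S uS ->]; have uSt : S^T \in unitmx by rewrite unitmx_tr.
suff -> : invmx (S^T *m S) = (invmx S^T)^T *m invmx S^T.
  by apply: posdef_gram; rewrite unitmx_inv.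
have u : S^T *m S \in unitmx by rewrite unitmx_mul uSt.
rewrite -[RHS](mulKmx u) -[LHS]mulmx1; congr (_ *m _).
by rewrite trmx_inv trmxK !mulmxA mulmxK // mulmxV.
Qed.

(** * Kronecker products *)

Lemma tensmx11 (R : realType) m n : (1%:M : 'M[R]_m) *t (1%:M : 'M[R]_n) = 1%:M.
Proof.
apply/matrixP => i j.
rewrite -(mxtens_unindexK i) -(mxtens_unindexK j).
case: (mxtens_unindex i) (mxtens_unindex j) => [i1 i2] [j1 j2].
rewrite tensmxE !mxE -natrM mulnb; congr (_%:R); congr nat_of_bool.
by rewrite (can_eq (@mxtens_indexK m n)).
Qed.

Lemma tensmx_inv (R : realType) m n (S : 'M[R]_m) (T : 'M[R]_n) :
  S \in unitmx -> T \in unitmx ->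
  (S *t T \in unitmx) /\ invmx (S *t T) = invmx S *t invmx T.
Proof.
move=> uS uT.
have E : (S *t T) *m (invmx S *t invmx T) = 1%:M.
  by rewrite tensmx_mul !mulmxV // tensmx11.
have [u _] := mulmx1_unit E; split=> //.
by rewrite -[RHS](mulKmx u) E mulmx1.
Qed.

Lemma tensmxDl (R : pzRingType) a b c d (M P : 'M[R]_(a, b)) (Q : 'M[R]_(c, d)) :
  (M + P) *t Q = M *t Q + P *t Q.
Proof. by apply/matrixP => i j; rewrite !mxE mulrDl. Qed.

Lemma tensmxDr (R : pzRingType) a b c d (Q : 'M[R]_(a, b)) (M P : 'M[R]_(c, d)) :
  Q *t (M + P) = Q *t M + Q *t P.
Proof. by apply/matrixP => i j; rewrite !mxE mulrDr. Qed.

Lemma tensmxNl (R : pzRingType) a b c d (M : 'M[R]_(a, b)) (Q : 'M[R]_(c, d)) :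
  (- M) *t Q = - (M *t Q).
Proof. by apply/matrixP => i j; rewrite !mxE mulNr. Qed.

Lemma tensmxNr (R : pzRingType) a b c d (Q : 'M[R]_(a, b)) (M : 'M[R]_(c, d)) :
  Q *t (- M) = - (Q *t M).
Proof. by apply/matrixP => i j; rewrite !mxE mulrN. Qed.

Lemma posdef_tens (R : realType) m n (S : 'M[R]_m) (T : 'M[R]_n) :
  posdefmx S -> posdefmx T -> posdefmx (S *t T).
Proof.
move=> /posdef_factor[S' uS ->] /posdef_factor[T' uT ->].
rewrite -tensmx_mul -trmx_tens; apply: posdef_gram.
by have [] := tensmx_inv uS uT.
Qed.

Lemma possemidef_tens (R : realType) m n (S : 'M[R]_m) (T : 'M[R]_n) :
  possemidefmx S -> possemidefmx T -> possemidefmx (S *t T).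
Proof.
move=> /possemidef_factor[S' ->] /possemidef_factor[T' ->].
by rewrite -tensmx_mul -trmx_tens; exact: possemidef_gram.
Qed.

(** * Balancing two positive definite matrices *)

Lemma char_poly_similar (R : fieldType) n (P M : 'M[R]_n) : P \in unitmx ->
  char_poly (P *m M *m invmx P) = char_poly M.
Proof.
move=> uP; pose f := map_mx (@polyC R).
have PP : f n n P *m f n n (invmx P) = 1%:M by rewrite -map_mxM mulmxV // map_mx1.
rewrite /char_poly.
have -> : char_poly_mx (P *m M *m invmx P) =
    f n n P *m char_poly_mx M *m f n n (invmx P).
  rewrite /char_poly_mx mulmxBr mulmxBl -!map_mxM.
  by rewrite mul_mx_scalar -scalemxAl PP scalemx1.
by rewrite !det_mulmx mulrAC -det_mulmx PP det1 mul1r.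
Qed.

(** Write [X = S^T S] and diagonalise [S Y S^T = U^T D U] with [U] orthogonal.
    In the coordinates [D^(1/4) U S^-T] both Gramians become [D^(1/2)], and
    [X Y] is similar to [D]. *)
Lemma balancing (R : realType) n (X Y : 'M[R]_n) : posdefmx X -> posdefmx Y ->
  exists (G : 'M[R]_n) (sigma : 'rV[R]_n),
    [/\ G \in unitmx, sorted_sqrt_eigenvalues (X *m Y) sigma,
        G *m X *m G^T = diag_mx sigma
      & (invmx G)^T *m Y *m invmx G = diag_mx sigma].
Proof.
move=> /posdef_factor[S uS XE] pY; have uSt : S^T \in unitmx by rewrite unitmx_tr.
have [U [d [UU SYS dd]]] : exists (U : 'M[R]_n) (d : 'rV[R]_n),
    [/\ U *m U^T = 1%:M, S *m Y *m S^T = U^T *m diag_mx d *m U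
      & forall i j : 'I_n, (i <= j)%N -> d 0 j <= d 0 i].
  by apply: symmetric_spectral_sorted; rewrite !trmx_mul trmxK pY.1 mulmxA.
have [uU _] := mulmx1_unit UU; have UtU : U^T *m U = 1%:M by exact: mulmx1C.
have d0 i : 0 < d 0 i.
  have [<- c0] := spectral_quad d i UU.
  rewrite -SYS -{1}[S]trmxK quad_mulmx; apply: pY.2.
  by apply: contra c0 => /eqP e; rewrite -[col i _](mulKmx uSt) e mulmx0.
pose sq (v : 'rV[R]_n) := map_mx Num.sqrt v.
have sq0 (v : 'rV[R]_n) : (forall i, 0 < v 0 i) -> forall i, 0 < sq v 0 i.
  by move=> v0 i; rewrite mxE sqrtr_gt0.
pose E := diag_mx (sq (sq d)).
have uE : E \in unitmx by apply/diag_mx_unit/sq0/sq0.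
have Et : E^T = E by rewrite tr_diag_mx.
have EE : E *m E = diag_mx (sq d).
  by rewrite [RHS]diag_sqrt -/E ?Et // => i; exact/ltW/sq0.
have DD : diag_mx d = diag_mx (sq d) *m diag_mx (sq d).
  by rewrite [LHS]diag_sqrt ?tr_diag_mx // => i; exact/ltW.
have uG : E *m U *m invmx S^T \in unitmx by rewrite !unitmx_mul uE uU unitmx_inv.
have Gi : invmx (E *m U *m invmx S^T) = S^T *m U^T *m invmx E.
  rewrite -[RHS](mulKmx uG) -[LHS]mulmx1; congr (_ *m _); symmetry.
  by rewrite !mulmxA mulmxKV // -[_ *m U *m U^T]mulmxA UU mulmx1 mulmxV.
exists (E *m U *m invmx S^T), (sq d); split => //.
- split=> [i j ij|]; first by rewrite !mxE ler_sqrt ?dd // ltW.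
  exists (d 0); split=> [|i]; last by rewrite mxE ltW.
  have -> : X *m Y = (S^T *m U^T) *m diag_mx d *m invmx (S^T *m U^T).
    rewrite XE.
    have -> : invmx (S^T *m U^T) = U *m invmx S^T.
      have u : S^T *m U^T \in unitmx by rewrite unitmx_mul uSt unitmx_tr.
      rewrite -[RHS](mulKmx u) -[LHS]mulmx1; congr (_ *m _); symmetry.
      by rewrite mulmxA -[_ *m U]mulmxA UtU mulmx1 mulmxV ?mulmx1.
    rewrite !mulmxA -2![in RHS](mulmxA S^T) -SYS.
    by rewrite !mulmxA mulmxK.
  rewrite char_poly_similar ?unitmx_mul ?uSt ?unitmx_tr //.
  rewrite char_poly_trig ?diag_mx_is_trig //.
  by apply: eq_bigr => i _; rewrite mxE eqxx.
- rewrite XE !trmx_mul Et trmx_inv trmxK !mulmxA mulmxKV //.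
  by rewrite mulmxK // -[_ *m U *m U^T]mulmxA UU mulmx1.
- rewrite Gi !trmx_mul !trmxK trmx_inv Et -!mulmxA.
  have -> : S *m (Y *m (S^T *m (U^T *m invmx E))) = U^T *m (diag_mx d *m invmx E).
    rewrite !mulmxA SYS -[_ *m U *m U^T]mulmxA UU mulmx1 //.
  rewrite [U *m _]mulmxA UU mul1mx DD -EE !mulmxA mulVmx // mul1mx.
  by rewrite mulmxK.
Qed.

(** * Observability of minimal realizations *)

(** If the row space of [V] is stable under [A] and contains the rows of [C],
    then [V A = A' V] and [C = C' V] for some [A'] and [C'], and
    [(A', V B, C')] realises the transfer function of [(A, B, C)]. *)
Lemma minimal_realization_stable_rank (R : realType) n m p
    (A : 'M[R]_n) (B : 'M[R]_(n, m)) (C : 'M[R]_(p, n)) r (V : 'M[R]_(r, n)) :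
  minimal_realization A B C -> stablemx V A -> (C <= V)%MS -> (n <= r)%N.
Proof.
move=> minABC /submxP[A' VA] /submxP[C' CV].
apply: (minABC r A' (V *m B) C'); rewrite /transfer_function CV.
set f := fun c : R => tofrac c%:P.
have fM a b c (M : 'M[R]_(a, b)) (P : 'M[R]_(b, c)) :
    map_mx f (M *m P) = map_mx f M *m map_mx f P.
  exact: (map_mxM (@tofrac {poly R} \o @polyC R)).
have uc k (M : 'M[R]_k) : map_mx (@tofrac _) (char_poly_mx M) \in unitmx.
  by rewrite unitmxE det_map_mx unitfE tofrac_eq0 monic_neq0 // char_poly_monic.
rewrite !fM -[in RHS]mulmxA -[in RHS]mulmxA; rewrite -[in LHS]mulmxA.
congr (_ *m _); rewrite !mulmxA; congr (_ *m _).
have VcA : map_mx f V *m map_mx (@tofrac _) (char_poly_mx A) =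
           map_mx (@tofrac _) (char_poly_mx A') *m map_mx f V.
  rewrite !(map_mx_comp (@polyC R) (@tofrac {poly R})) -!map_mxM; congr map_mx.
  rewrite mulmxBr mulmxBl mul_mx_scalar mul_scalar_mx; congr (_ - _).
  by rewrite -!map_mxM VA.
by rewrite -[X in _ *m X](mulmxK (uc n A)) VcA mulmxA mulKmx.
Qed.

(** Observability of a minimal realization, as an induction principle. A
    property of row spaces that is closed under sums, subspaces and
    multiplication by [A] has a largest member [V]. As [V] is stable under [A]
    and contains the rows of [C], minimality makes it the whole space. *)
Lemma observable_ind (R : realType) n m p
    (A : 'M[R]_n) (B : 'M[R]_(n, m)) (C : 'M[R]_(p, n))
    (Z : forall k, 'M[R]_(k, n) -> Prop) :
  minimal_realization A B C ->
  (forall k l (V : 'M[R]_(k, n)) (W : 'M[R]_(l, n)), Z k V -> (W <= V)%MS -> Z l W) ->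
  (forall (V W : 'M[R]_n), Z n V -> Z n W -> Z n (V + W)%MS) ->
  (forall (V : 'M[R]_n), Z n V -> Z n (V *m A)) ->
  Z p C -> Z n 1%:M.
Proof.
move=> minABC Zsub ZD ZA ZC.
pose P r := `[< exists2 V : 'M[R]_n, Z n V & \rank V = r >].
have exP : exists r, P r.
  by exists (\rank <<C>>%MS); apply/asboolP; exists <<C>>%MS => //;
    apply: Zsub ZC _; rewrite genmxE.
have ubP r : P r -> (r <= n)%N by move=> /asboolP[V _ <-]; exact: rank_leq_col.
case: (ex_maxnP exP ubP) => r /asboolP[V ZV <-] maxV.
have sub (W : 'M[R]_n) : Z n W -> (W <= V)%MS.
  move=> ZW; apply: submx_trans (addsmxSr V W) _.
  rewrite -(mxrank_leqif_sup (addsmxSl V W)).2.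
  rewrite eqn_leq mxrankS ?addsmxSl //=.
  exact: maxV _ (introT (asboolP _) (ex_intro2 _ _ _ (ZD _ _ ZV ZW) erefl)).
have full : (n <= \rank V)%N.
  apply: (minimal_realization_stable_rank (V := row_base V) minABC).
  - by rewrite stablemx_row_base; apply: sub; exact: ZA.
  - rewrite eq_row_base -(genmxE C); apply: sub.
    by apply: Zsub ZC _; rewrite genmxE.
by apply: Zsub ZV _; rewrite sub1mx -col_leq_rank.
Qed.

(** * Quadratic Lyapunov functions *)

(** In Barbalat's lemma the derivative of a convergent function tends to zero
    as soon as it is uniformly continuous; here a bound [K] on the second
    derivative provides the uniform continuity. On an interval of length
    [h = e / (2 (K + 1))] the derivative takes, by the mean value theorem, a
    value of size at most [e / 2], and varies by at most [e / 2]. *)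
Lemma derivative_cvg0 (R : realType) (f f1 f2 : R -> R) (K l : R) :
  (forall t : R, 0 <= t -> is_derive t 1 f (f1 t)) ->
  (forall t : R, 0 <= t -> is_derive t 1 f1 (f2 t)) ->
  (forall t : R, 0 <= t -> `|f2 t| <= K) ->
  (f t @[t --> +oo%R] --> l)%classic -> (f1 t @[t --> +oo%R] --> (0 : R))%classic.
Proof.
move=> df df1 bK fl.
have mvt (g g1 : R -> R) (a b : R) : (forall t : R, 0 <= t -> is_derive t 1 g (g1 t)) ->
    0 <= a -> a < b -> exists c, [/\ a < c, c < b & g b - g a = g1 c * (b - a)].
  move=> dg a0 ab.
  have [||c] := MVT (f := g) (df := g1) ab.
  - by move=> x; rewrite in_itv /= => /andP[/ltW/(le_trans a0)/dg].
  - apply: derivable_within_continuous => x; rewrite in_itv /= => /andP[ax _].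
    exact: (@ex_derive _ _ _ _ _ _ _ (dg x (le_trans a0 ax))).
  - by rewrite in_itv /= => /andP[ac cb] e; exists c.
have K0 : 0 <= K by exact: le_trans (normr_ge0 _) (bK 0 (lexx 0)).
apply/cvgr0Pnorm_le => e e0.
pose h := e / (2 * (K + 1)).
have K1 : 0 < K + 1 by rewrite ltr_wpDl.
have h0 : 0 < h by rewrite divr_gt0 // mulr_gt0.
(* beyond [T], two values of [f] differ by at most [e h / 2] *)
have eh0 : 0 < e * h / 4 := divr_gt0 (mulr_gt0 e0 h0) (ltr0Sn _ 3).
have [T [_ HT]] := (cvgrPdist_le (f : R -> R^o) l).1 fl _ eh0.
exists (Num.max T 0); split; first exact: num_real.
move=> t; rewrite gt_max => /andP[Tt /ltW t0].
have [c [tc ct]] := mvt _ _ t (t + h) df t0 (ltr_pwDr h0 (lexx t)).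
rewrite [t + h - t]addrAC subrr add0r => fc.
have c0 := le_trans t0 (ltW tc).
have fc2 : `|f1 c| <= e / 2.
  rewrite -(ler_pM2r h0) -[X in _ * X <= _](gtr0_norm h0) -normrM -fc.
  have := HT _ Tt; have := HT _ (lt_trans Tt (ltr_pwDr h0 (lexx t))).
  rewrite !ler_norml => /andP[? ?] /andP[? ?].
  by apply/andP; split; lra.
have [c' [tc' cc']] := mvt _ _ t c df1 t0 tc.
have := bK _ (le_trans t0 (ltW tc')); have := fc2.
have Kh : K * h <= e / 2.
  rewrite /h mulrCA ler_pM2l // invfM mulrCA ler_piMr ?invr_ge0 // ler_pdivrMr //.
  by rewrite mul1r lerDl.
move=> fce K2 E.
have : `|f1 c - f1 t| <= e / 2.
  rewrite E normrM (gtr0_norm (_ : 0 < c - t)) ?subr_gt0 //.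
  apply: le_trans Kh; apply: ler_pM => //; first by rewrite subr_ge0 ltW.
  by rewrite lerBlDl ltW.
move: fce; rewrite !ler_norml => /andP[? ?] /andP[? ?].
by apply/andP; split; lra.
Qed.

Lemma cvg0_sum (R : realType) n (f : 'I_n -> R -> R) :
  (forall i, (f i t @[t --> +oo%R] --> (0 : R))%classic) ->
  ((\sum_i f i t) @[t --> +oo%R] --> (0 : R))%classic.
Proof.
move=> f0; have -> : (fun t => \sum_i f i t) = \sum_i f i by rewrite fct_sumE.
apply: (big_ind (fun g : R -> R => (g t @[t --> +oo%R] --> (0 : R))%classic)) => //.
- exact: cvg_cst.
- by move=> g1 g2 g10 g20; rewrite -(addr0 0); exact: cvgD.
Qed.

Lemma is_derive_mulmx (R : realType) a b c (t : R)
    (z : R -> 'M[R]_(a, b)) (dz : 'M[R]_(a, b))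
    (y : R -> 'M[R]_(b, c)) (dy : 'M[R]_(b, c)) :
  (forall i j, is_derive t 1 (fun u => z u i j) (dz i j)) ->
  (forall i j, is_derive t 1 (fun u => y u i j) (dy i j)) ->
  forall i j, is_derive t 1 (fun u => (z u *m y u) i j)
                ((dz *m y t + z t *m dy) i j).
Proof.
move=> hz hy i j.
have -> : (fun u => (z u *m y u) i j) =
    \sum_k ((fun u => z u i k) * (fun u => y u k j)).
  by rewrite fct_sumE; apply/funext => u; rewrite mxE.
apply: is_derive_eq; rewrite !mxE -big_split /=; apply: eq_bigr => k _.
by rewrite addrC; congr (_ + _); exact: mulrC.
Qed.

Lemma trajectory_mulmx (R : realType) k n (M : 'M[R]_n) (Q : 'M[R]_(k, n)) z (t : R) i :
  trajectory M z -> 0 <= t ->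
  is_derive t 1 (fun u => (Q *m z u) i ord0) ((Q *m M *m z t) i ord0).
Proof.
move=> zM t0.
have -> : Q *m M *m z t = 0 *m z t + Q *m (M *m z t) by rewrite mul0mx add0r mulmxA.
apply: (is_derive_mulmx (z := fun=> Q)) => [a b|a b].
  by rewrite mxE; exact: is_derive_cst.
by rewrite ord1; exact: zM.
Qed.

Lemma trajectory_quad (R : realType) n (M : 'M[R]_n) (W : 'M[R]_n) z (t : R) :
  trajectory M z -> 0 <= t ->
  is_derive t 1 (fun u => ((z u)^T *m W *m z u) ord0 ord0)
    (((z t)^T *m (M^T *m W + W *m M) *m z t) ord0 ord0).
Proof.
move=> zM t0.
have -> : (z t)^T *m (M^T *m W + W *m M) *m z t =
   ((M *m z t)^T *m W + (z t)^T *m (0 : 'M_n)) *m z t + (z t)^T *m W *m (M *m z t).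
  by rewrite mulmx0 addr0 trmx_mul mulmxDr mulmxDl !mulmxA.
apply: is_derive_mulmx => [a b|a b]; last by rewrite ord1; exact: zM.
apply: (is_derive_mulmx (y := fun=> W)) => [c d|c d].
  have -> : (fun u => (z u)^T c d) = (fun u => z u d ord0).
    by apply/funext => u; rewrite mxE ord1.
  by rewrite mxE (ord1 c); exact: zM.
by rewrite mxE; exact: is_derive_cst.
Qed.

Lemma mulmx_norm_le (R : realType) k n (Q : 'M[R]_(k, n)) (x : 'cV[R]_n) (K : R) i :
  (forall j, `|x j ord0| <= K) -> `|(Q *m x) i ord0| <= (\sum_j `|Q i j|) * K.
Proof.
move=> xK; rewrite mxE mulr_suml; apply: le_trans (ler_norm_sum _ _ _) _.
by apply: ler_sum => j _; rewrite normrM ler_wpM2l.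
Qed.

Lemma quad_norm_le (R : realType) n (W : 'M[R]_n) (x : 'cV[R]_n) (K : R) :
  (forall j, `|x j ord0| <= K) ->
  `|(x^T *m W *m x) ord0 ord0| <= (\sum_i \sum_j `|W i j|) * K ^+ 2.
Proof.
move=> xK; rewrite -mulmxA mxE mulr_suml; apply: le_trans (ler_norm_sum _ _ _) _.
apply: ler_sum => j _; rewrite normrM mxE expr2 mulrCA.
by apply: ler_pM => //; exact: mulmx_norm_le.
Qed.

Lemma sqr_entry_le (R : realType) n (x : 'cV[R]_n) i :
  x i ord0 ^+ 2 <= (x^T *m x) ord0 ord0.
Proof.
rewrite mxE (bigD1 i) //= mxE -expr2 lerDl.
by apply: sumr_ge0 => k _; rewrite mxE -expr2 sqr_ge0.
Qed.

(** Writing [P = S^T S], the quadratic form is [|S x|^2] and [x] is recovered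
    as [S^-1 (S x)]. *)
Lemma posdef_coercive (R : realType) n (P : 'M[R]_n) : posdefmx P ->
  exists2 c : R, 0 <= c & forall (x : 'cV[R]_n) i,
    `|x i ord0| <= c * Num.sqrt ((x^T *m P *m x) ord0 ord0).
Proof.
move=> /posdef_factor[S uS ->].
exists (\sum_i \sum_j `|invmx S i j|) => [|x i].
  by apply: sumr_ge0 => i _; apply: sumr_ge0.
rewrite -[S^T]mulmx1 quad_mulmx mulmx1.
set q := Num.sqrt _; have q0 : 0 <= q by exact: sqrtr_ge0.
rewrite -{1}[x](mulKmx uS).
apply: le_trans (_ : _ <= (\sum_j `|invmx S i j|) * q) _.
  apply: mulmx_norm_le => j; rewrite -sqrtr_sqr ler_wsqrtr //; exact: sqr_entry_le.
apply: ler_wpM2r => //; rewrite [X in _ <= X](bigD1 i) //= lerDl.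
by apply: sumr_ge0 => k _; apply: sumr_ge0.
Qed.

Lemma lyapunov_nonincreasing (R : realType) n (M P : 'M[R]_n) z (s t : R) :
  loewner_le (M^T *m P + P *m M) 0 -> trajectory M z -> 0 <= s -> s <= t ->
  ((z t)^T *m P *m z t) ord0 ord0 <= ((z s)^T *m P *m z s) ord0 ord0.
Proof.
move=> [_ dec] zM s0 st.
pose V u := ((z u)^T *m P *m z u) ord0 ord0; rewrite -/(V t) -/(V s).
have dV (x : R) : 0 <= x -> is_derive x 1 V _ := trajectory_quad P zM.
apply: (ler0_derive1_nincry (a := s)) => //.
- move=> x; rewrite in_itv /= andbT => /ltW sx.
  exact: (@ex_derive _ _ _ _ _ _ _ (dV x (le_trans s0 sx))).
- move=> x; rewrite in_itv /= andbT => /ltW sx.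
  rewrite derive1E (@derive_val _ _ _ _ _ _ _ (dV x (le_trans s0 sx))).
  by have := dec (z x); rewrite sub0r mulmxN mulNmx mxE oppr_ge0.
- apply: derivable_within_continuous => x; rewrite in_itv /= andbT => sx.
  exact: (@ex_derive _ _ _ _ _ _ _ (dV x (le_trans s0 sx))).
Qed.

(** The sublevel sets of [x^T P x] are bounded and positively invariant. *)
Lemma lyapunov_stable (R : realType) n (M P : 'M[R]_n) :
  posdefmx P -> loewner_le (M^T *m P + P *m M) 0 ->
  exists2 c : R, 0 <= c & forall z (K : R), trajectory M z ->
    (forall i, `|z 0 i ord0| <= K) ->
    forall (t : R) i, 0 <= t -> `|z t i ord0| <= c * K.
Proof.
move=> pP dec; have [c c0 cP] := posdef_coercive pP.
pose w := \sum_i \sum_j `|P i j|.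
have w0 : 0 <= w by apply: sumr_ge0 => i _; apply: sumr_ge0.
exists (c * Num.sqrt w) => [|z K zM zK t i t0]; first by rewrite mulr_ge0 ?sqrtr_ge0.
have K0 : 0 <= K by exact: le_trans (normr_ge0 _) (zK i).
apply: le_trans (cP _ _) _; rewrite -mulrA ler_wpM2l //.
rewrite -[X in _ * X](ger0_norm K0) -sqrtr_sqr -sqrtrM // ler_wsqrtr //.
apply: le_trans (lyapunov_nonincreasing dec zM (lexx 0) t0) _.
exact: le_trans (ler_norm _) (quad_norm_le P zK).
Qed.

Definition output_vanishes (R : realType) k n (z : R -> 'cV[R]_n) (Q : 'M[R]_(k, n)) :=
  forall i, ((Q *m z t) i ord0 @[t --> +oo%R] --> (0 : R))%classic.

Lemma output_vanishesM (R : realType) k l n (z : R -> 'cV[R]_n)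
    (Q : 'M[R]_(k, n)) (W : 'M[R]_(l, k)) :
  output_vanishes z Q -> output_vanishes z (W *m Q).
Proof.
move=> zQ i; have -> : (fun t => (W *m Q *m z t) i ord0) =
    (fun t => \sum_j W i j * (Q *m z t) j ord0).
  by apply/funext => t; rewrite -mulmxA mxE.
apply: cvg0_sum => j; rewrite -(mulr0 (W i j)).
by apply: cvgM; [exact: cvg_cst|exact: zQ].
Qed.

Lemma output_vanishesD (R : realType) k n (z : R -> 'cV[R]_n) (Q W : 'M[R]_(k, n)) :
  output_vanishes z Q -> output_vanishes z W -> output_vanishes z (Q + W).
Proof.
move=> zQ zW i; have -> : (fun t => ((Q + W) *m z t) i ord0) =
    (fun t => (Q *m z t) i ord0 + (W *m z t) i ord0).
  by apply/funext => t; rewrite mulmxDl mxE.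
by rewrite -(addr0 0); apply: cvgD.
Qed.

(** [Q M z] is the derivative of [Q z], and its own derivative is bounded. *)
Lemma output_vanishes_derivative (R : realType) k n (M : 'M[R]_n) z
    (K : R) (Q : 'M[R]_(k, n)) :
  trajectory M z -> (forall (t : R) i, 0 <= t -> `|z t i ord0| <= K) ->
  output_vanishes z Q -> output_vanishes z (Q *m M).
Proof.
move=> zM zK zQ i.
pose out k' (W : 'M[R]_(k', n)) i' (t : R) := (W *m z t) i' ord0.
apply: (@derivative_cvg0 R (out k Q i) (out k (Q *m M) i) (out k (Q *m M *m M) i)
  ((\sum_j `|(Q *m M *m M) i j|) * K) 0 _ _ _ (zQ i)) => t t0.
- exact: trajectory_mulmx.
- exact: trajectory_mulmx.
- by apply: mulmx_norm_le => j; exact: zK.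
Qed.

(** The energy [z^T P z] is nonincreasing, hence convergent, so its derivative,
    which is at most [- |D z|^2], tends to zero. *)
Lemma output_vanishes_dissipated (R : realType) k n (M P : 'M[R]_n)
    (D : 'M[R]_(k, n)) z (K : R) :
  posdefmx P -> loewner_le (M^T *m P + P *m M + D^T *m D) 0 ->
  trajectory M z -> (forall (t : R) i, 0 <= t -> `|z t i ord0| <= K) ->
  output_vanishes z D.
Proof.
move=> pP hD zM zK i; have dissip := hD.2.
pose W := M^T *m P + P *m M.
have dec := loewner_le0_drop_gram hD; rewrite -/W in dec.
pose V t := ((z t)^T *m P *m z t) ord0 ord0.
(* the energy is monotone at nonnegative times only, so that it is replaced by
   [V 0] at the negative ones *)
pose g t := - V (Num.max 0 t).
have gl : (g t @[t --> +oo%R] --> sup (range g))%classic.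
  apply: nondecreasing_cvgr => [x y xy|].
    rewrite lerN2; apply: (lyapunov_nonincreasing dec zM).
      by rewrite le_max lexx.
    by rewrite ge_max le_max lexx /= le_max xy orbT.
  exists 0 => _ [t _ <-]; rewrite oppr_le0.
  exact: (posdef_possemidef pP).2.
have Vl : (V t @[t --> +oo%R] --> - sup (range g))%classic.
  apply: cvg_trans (cvgN gl); apply: near_eq_cvg.
  by exists 0; split => // t /ltW t0; rewrite /g /= opprK (max_idPr t0).
pose V1 t := ((z t)^T *m W *m z t) ord0 ord0.
have V10 : (V1 t @[t --> +oo%R] --> (0 : R))%classic.
  pose W2 := M^T *m W + W *m M.
  apply: (@derivative_cvg0 R V V1 (fun t => ((z t)^T *m W2 *m z t) ord0 ord0)
    ((\sum_i \sum_j `|W2 i j|) * K ^+ 2) _ _ _ _ Vl) => t t0.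
  - exact: trajectory_quad.
  - exact: trajectory_quad.
  - by apply: quad_norm_le => j; exact: zK.
have Dz t : ((D *m z t) i ord0) ^+ 2 <= - V1 t.
  have := dissip (z t); rewrite sub0r mulmxN mulNmx mxE mulmxDr mulmxDl mxE -/(V1 t).
  rewrite opprD subr_ge0; apply: le_trans.
  rewrite -[D^T]mulmx1 quad_mulmx mulmx1.
  exact: sqr_entry_le.
apply/cvgr0Pnorm_le => e e0.
have /cvgr0Pnorm_le/(_ _ (exprn_gt0 2 e0))[T [rT HT]] := V10.
exists T; split=> // t Tt.
rewrite -(ler_pXn2r (isT : (0 < 2)%N)) ?nnegrE ?normr_ge0 ?(ltW e0) //.
rewrite real_normK ?num_real //; apply: le_trans (Dz t) _.
by apply: le_trans (HT t Tt); rewrite -normrN ler_norm.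
Qed.

(** * The synchronisation error system *)

(** Congruence by [K^-1] turns [A^T K + K A] into [K^-1 A^T + A K^-1], and
    [C = B^T K] reads [B^T = C K^-1]. *)
Lemma passivity_solution_dual (R : realType) n m (A : 'M[R]_n) (B : 'M[R]_(n, m))
    (C : 'M[R]_(m, n)) K :
  passivity_solution A B C K -> passivity_solution A^T C^T B^T (invmx K).
Proof.
move=> [pK dK CK]; have uK := posdef_unit pK; have piK := posdef_inv pK.
split=> //; last by rewrite CK trmxK mulmxK.
have := possemidef_congr (invmx K) dK.
rewrite /loewner_le piK.1 !sub0r trmxK mulmxN mulNmx; congr (possemidefmx (- _)).
rewrite mulmxDr mulmxDl !mulmxA mulmxK // mulVmx // mul1mx.
by rewrite addrC.
Qed.

Lemma trmx_Phi (R : realType) d n m (Lam : 'M[R]_d) (A : 'M[R]_n) (B : 'M[R]_(n, m))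
    (C : 'M[R]_(m, n)) :
  Lam^T = Lam -> (Phi Lam A B C)^T = Phi Lam A^T C^T B^T.
Proof. by move=> sL; rewrite /Phi linearB /= !trmx_tens trmx1 trmx_mul sL. Qed.

(** The relation [C = B^T K] turns the coupling terms [C^T B^T K] and [K B C]
    both into [C^T C]. *)
Lemma Phi_lyapunov (R : realType) d n m (Lam Y : 'M[R]_d) (A K : 'M[R]_n)
    (B : 'M[R]_(n, m)) (C : 'M[R]_(m, n)) :
  Lam^T = Lam -> K^T = K -> C = B^T *m K ->
  (Phi Lam A B C)^T *m (Y *t K) + (Y *t K) *m Phi Lam A B C =
  Y *t (A^T *m K + K *m A) - (Lam *m Y + Y *m Lam) *t (C^T *m C).
Proof.
move=> sL sK CK; have CtK : C^T = K *m B by rewrite CK trmx_mul trmxK sK.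
rewrite trmx_Phi // /Phi mulmxBl mulmxBr !tensmx_mul mul1mx mulmx1.
rewrite -[C^T *m B^T *m K]mulmxA -CK [K *m (B *m C)]mulmxA -CtK.
by rewrite tensmxDr tensmxDl opprD addrACA.
Qed.

(** By [Phi_lyapunov], the left-hand side of the Gramian inequality is
    [Y (x) (A^T K + K A) + (- Lam Y - Y Lam + H^T H) (x) C^T C]. *)
Lemma gen_observability_gramian_tens (R : realType) d n m q (Lam Y : 'M[R]_d)
    (A K : 'M[R]_n) (B : 'M[R]_(n, m)) (C : 'M[R]_(m, n)) (H : 'M[R]_(q, d)) :
  Lam^T = Lam -> posdefmx Y -> passivity_solution A B C K ->
  loewner_le (- (Lam *m Y) - Y *m Lam + H^T *m H) 0 ->
  gen_observability_gramian (Phi Lam A B C) (H *t C) (Y *t K).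
Proof.
move=> sL pY [pK dK CK] dY; split; first exact: posdef_tens.
rewrite /loewner_le Phi_lyapunov ?pK.1 // trmx_tens tensmx_mul.
have -> : 0 - (Y *t (A^T *m K + K *m A) - (Lam *m Y + Y *m Lam) *t (C^T *m C)
               + (H^T *m H) *t (C^T *m C)) =
   Y *t (0 - (A^T *m K + K *m A)) +
   (0 - (- (Lam *m Y) - Y *m Lam + H^T *m H)) *t (C^T *m C).
  rewrite -[- (Lam *m Y) - _]opprD !sub0r tensmxNr tensmxNl -opprD.
  by congr (- _); rewrite -addrA; congr (_ + _); rewrite [RHS]tensmxDl tensmxNl.
apply: possemidefD; apply: possemidef_tens => //; first exact: posdef_possemidef.
exact: possemidef_gram.
Qed.

(** The energy [z^T (I (x) K) z] dissipates [(S (x) C) z], where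
    [Lam = S^T S] with [S] invertible, so that [(I (x) C) z] tends to zero;
    observability of [(A, C)] extends this to the whole state. *)
Lemma Phi_asymptotically_stable (R : realType) d n m (Lam : 'M[R]_d) (A K : 'M[R]_n)
    (B : 'M[R]_(n, m)) (C : 'M[R]_(m, n)) :
  minimal_realization A B C -> passivity_solution A B C K -> posdefmx Lam ->
  asymptotically_stable (Phi Lam A B C).
Proof.
move=> minABC [pK dK CK] pL; set M := Phi Lam A B C.
have [S uS LS] := posdef_factor pL.
pose P := (1%:M : 'M[R]_d) *t K.
have pP : posdefmx P by apply: posdef_tens => //; exact: posdef1.
have diss : loewner_le (M^T *m P + P *m M + (S *t C)^T *m (S *t C)) 0.
  rewrite /loewner_le Phi_lyapunov ?pK.1 ?pL.1 // trmx_tens tensmx_mul -LS.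
  have half (U V : 'M[R]_(d * n)) : U - (V + V) + V = U - V.
    by rewrite opprD addrA subrK.
  rewrite mulmx1 mul1mx tensmxDl half sub0r opprD opprK -tensmxNr.
  apply: possemidefD; apply: possemidef_tens.
  - exact: posdef_possemidef (posdef1 _ _).
  - by rewrite -sub0r.
  - exact: posdef_possemidef.
  - exact: possemidef_gram.
have dec := loewner_le0_drop_gram diss.
have [c c0 bnd] := lyapunov_stable pP dec.
split=> [e e0|z zM].
  exists (e / (c + 1)) => [|z zM z0 t i t0]; first by rewrite divr_gt0 // ltr_wpDl.
  apply: le_lt_trans (bnd z _ zM (fun j => ltW (z0 j)) t i t0) _.
  by rewrite mulrCA gtr_pMr // ltr_pdivrMr ?mul1r ?ltrDl // ltr_wpDl.
have [K0 zK] : exists K0 : R, forall (t : R) i, 0 <= t -> `|z t i ord0| <= K0.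
  exists (c * \sum_i `|z 0 i ord0|) => t i t0; apply: bnd => // j.
  by rewrite (bigD1 j) //= lerDl sumr_ge0.
have zC : output_vanishes z ((1%:M : 'M[R]_d) *t C).
  have -> : 1%:M *t C = (invmx S *t 1%:M) *m (S *t C).
    by rewrite tensmx_mul mulVmx // mul1mx.
  exact: output_vanishesM (output_vanishes_dissipated pP diss zM zK).
pose Z k (Q : 'M[R]_(k, n)) := output_vanishes z ((1%:M : 'M[R]_d) *t Q).
have : Z n 1%:M.
  apply: (observable_ind (Z := Z) minABC) => //.
  - move=> k l V W ZV /submxP[D ->]; rewrite /Z -[1%:M]mulmx1 -tensmx_mul.
    exact: output_vanishesM.
  - move=> V W ZV ZW; have /sub_addsmxP[D ->] := submx_refl (V + W)%MS.
    rewrite /Z tensmxDr -[1%:M]mulmx1 -!tensmx_mul.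
    by apply: output_vanishesD; exact: output_vanishesM.
  (* the derivative of [(I (x) V) z] is [(I (x) V A) z], up to a term that
     factors through [(I (x) C) z] *)
  - move=> V ZV; rewrite /Z.
    have -> : (1%:M : 'M[R]_d) *t (V *m A) =
        (1%:M *t V) *m M + (Lam *t (V *m B)) *m (1%:M *t C).
      rewrite /M /Phi mulmxBr !tensmx_mul !mul1mx mulmx1 mulmxA.
      by rewrite subrK.
    apply: output_vanishesD; last exact: output_vanishesM.
    exact: output_vanishes_derivative zM zK ZV.
rewrite /Z tensmx11 => z0 i; have := z0 i.
by under eq_fun do rewrite mul1mx.
Qed.

Theorem theorem7 (R : realType) (n m N p q : nat)
  (A : 'M[R]_n) (B : 'M[R]_(n, m)) (C : 'M[R]_(m, n))
  (hmin : minimal_realization A B C)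
  (hpass : passive_realization A B C)
  (w : 'M[R]_N)
  (hw : weighted_graph w)
  (hconn : connected_graph w)
  (F : 'M[R]_(N, p)) (H : 'M[R]_(q, N))
  (s : nat) (mult : 'I_s -> nat) (lam : 'I_s -> R)
  (hN : N = (\sum_(i < s) mult i).+1)
  (hmult : forall i : 'I_s, (0 < mult i)%N)
  (hlam : forall i : 'I_s, 0 < lam i)
  (hlam_decr : forall i j : 'I_s, (i < j)%N -> lam j < lam i)
  (T1 : 'M[R]_(N, \sum_(i < s) mult i)) (T2 : 'M[R]_(N, 1))
  (hT2 : T2 = (Num.sqrt N%:R)^-1 *: const_mx 1)
  (hT : orthogonalmx (row_mx T1 T2))
  (hL : laplacian w =
        row_mx T1 T2 *m block_mx (Lambdabar mult lam) 0 0 0 *m (row_mx T1 T2)^T)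
  (X : 'M[R]_(\sum_(i < s) mult i))
  (Yb : forall i : 'I_s, 'M[R]_(mult i))
  (hXpos : posdefmx X)
  (hYpos : forall i : 'I_s, posdefmx (Yb i))
  (Km KM : 'M[R]_n)
  (hKm : minimum_solution A B C Km)
  (hKM : maximum_solution A B C KM) :
  let Lam := Lambdabar mult lam in
  let Fbar := T1^T *m F in
  let Hbar := H *m T1 in
  let Y := \mxdiag_(i < s) Yb i in
  - (Lam *m X) - X *m Lam + Fbar *m Fbar^T = 0 ->
  loewner_le (- (Lam *m Y) - Y *m Lam + Hbar^T *m Hbar) 0 ->
  let calX := X *t invmx KM in
  let calY := Y *t Km in
  [/\ asymptotically_stable (Phi Lam A B C),
      gen_controllability_gramian (Phi Lam A B C) (Fbar *t B) calX,
      gen_observability_gramian (Phi Lam A B C) (Hbar *t C) calY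
    & exists (TG : 'M[R]_(\sum_(i < s) mult i)) (TD : 'M[R]_n)
        (sigma : 'rV[R]_(\sum_(i < s) mult i)) (tau : 'rV[R]_n),
        [/\ TG \in unitmx /\ TD \in unitmx,
            sorted_sqrt_eigenvalues (X *m Y) sigma,
            sorted_sqrt_eigenvalues (invmx KM *m Km) tau,
            (TG *t TD) *m calX *m (TG *t TD)^T = diag_mx sigma *t diag_mx tau
          & (invmx (TG *t TD))^T *m calY *m invmx (TG *t TD) =
            diag_mx sigma *t diag_mx tau]].
Proof.
move=> Lam Fbar Hbar Y hX hY calX calY.
have pL : posdefmx Lam.
  apply: posdef_mxdiag => i; rewrite -[(lam i)%:M]mulmx1 mul_scalar_mx.
  have [s1 p1] := posdef1 R (mult i).
  split=> [|x x0]; first by rewrite linearZ /= s1.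
  by rewrite -scalemxAr -scalemxAl mxE mulr_gt0 ?hlam ?p1.
have pY : posdefmx Y by exact: posdef_mxdiag.
have [pKM _] := hKM; have [pKm _] := hKm.
split.
- exact: Phi_asymptotically_stable hmin pKm pL.
(* a controllability Gramian is an observability Gramian of the dual system *)
- have := gen_observability_gramian_tens (H := Fbar^T) pL.1 hXpos
    (passivity_solution_dual pKM).
  rewrite trmxK hX => /(_ (loewner_le_refl _)).
  rewrite -trmx_Phi ?pL.1 // -trmx_tens.
  by rewrite /gen_observability_gramian /gen_controllability_gramian !trmxK.
- exact: gen_observability_gramian_tens pL.1 pY pKm hY.
- have [TG [sigma [uG eG XG YG]]] := balancing hXpos pY.
  have [pKM' _ _] := pKM; have [pKm' _ _] := pKm.
  have [TD [tau [uD eD XD YD]]] := balancing (posdef_inv pKM') pKm'.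
  have [_ iT] := tensmx_inv uG uD.
  exists TG, TD, sigma, tau; split=> //.
    by rewrite trmx_tens !tensmx_mul XG XD.
  by rewrite iT trmx_tens !tensmx_mul YG YD.
Qed.
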